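(* For every real $\alpha\in(0,1)$ (rational or irrational) there exists an infinite binary word that is not ultimately periodic, is prefix normal, and has minimum density $\alpha$. Moreover, for every ultimately periodic infinite prefix normal binary word $w$, the minimum density $\delta(w)$ is a rational number.
   Context: Binary words are indexed from $1$. For a binary word $w$, $P_w(i)$ is the number of $1$s in the prefix of length $i$ and $D_w(i)=P_w(i)/i$. The minimum density of $w$ is $\delta(w)=\inf\{D_w(i) : i\ge 1\}$. An infinite word $w$ is prefix normal if for every $i\ge1$ every factor of $w$ of length $i$ has at most $P_w(i)$ ones. An infinite word is ultimately periodic if it equals $vu^{\omega}$ for some finite word $v$ (possibly empty) and nonempty finite word $u$; a word that is not ultimately periodic is called aperiodic. *)

(* Defs.v *)
From HB Require Import structures.
From mathcomp Require Import all_boot all_order all_algebra.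
From mathcomp Require Import all_classical all_reals.

Set Implicit Arguments.
Unset Strict Implicit.
Unset Printing Implicit Defensive.

Import Order.TTheory GRing.Theory Num.Theory.

Local Open Scope classical_set_scope.
Local Open Scope ring_scope.

(* The letter at (1-based) position i.+1 of an infinite binary word w is w i,
   with true standing for 1 and false for 0. *)
Definition iword := nat -> bool.

(* factor w k n is the factor of length n at 1-based positions k+1, ..., k+n;
   factor w 0 n is the prefix of length n. *)
Definition factor (w : iword) (k n : nat) : seq bool :=
  [seq w j | j <- iota k n].

Definition ones (u : seq bool) : nat := count_mem true u.

Definition prefix_ones (w : iword) (i : nat) : nat := ones (factor w 0 i).

Definition prefix_density (R : realType) (w : iword) (i : nat) : R :=
  (prefix_ones w i)%:R / i%:R.

Definition min_density (R : realType) (w : iword) : R :=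
  inf [set prefix_density R w i | i in [set i : nat | (1 <= i)%N]].

Definition prefix_normal (w : iword) : Prop :=
  forall i k : nat, (1 <= i)%N -> (ones (factor w k i) <= prefix_ones w i)%N.

(* u^omega, for a nonempty word u *)
Definition omega_power (u : seq bool) : iword :=
  fun i => nth false u (i %% size u)%N.

Definition prepend (v : seq bool) (x : iword) : iword :=
  fun i => if (i < size v)%N then nth false v i else x (i - size v)%N.

Definition ultimately_periodic (w : iword) : Prop :=
  exists v u : seq bool, u != [::] /\ w = prepend v (omega_power u).

Definition aperiodic (w : iword) : Prop := ~ ultimately_periodic w.

(* Main.v *)
Require Import Defs.
From HB Require Import structures.
From mathcomp Require Import all_boot all_order all_algebra.
From mathcomp Require Import all_classical all_reals.
From mathcomp Require Import zify lra.

Set Implicit Arguments.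
Unset Strict Implicit.
Unset Printing Implicit Defensive.

Import Order.TTheory GRing.Theory Num.Theory.

Local Open Scope classical_set_scope.
Local Open Scope ring_scope.

(** A word is prefix normal iff its prefix-ones function P is subadditive.
    If g is subadditive with increments in [0, 1], then so is the integer-valued
    function ceil g, which is therefore the prefix-ones function of a prefix
    normal word. Take g n = alpha n + (1 - alpha) sqrt n: the density P n / n
    stays above alpha and tends to alpha, while P n - alpha n is unbounded but
    sublinear, which excludes ultimate periodicity (there P n is an affine
    function of n up to a bounded error).

    For an ultimately periodic word with period q, preperiod a, and p ones per
    period, P (i + q) = P i + p for i >= a, so by the mediant inequality the
    minimum density is the least of p / q and the finitely many densities
    P i / i with 1 <= i <= a + q. *)

(** * Prefix counts of a word *)

Lemma prefix_onesD (w : iword) (k i : nat) :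
  prefix_ones w (k + i) = (prefix_ones w k + ones (Defs.factor w k i))%N.
Proof. by rewrite /prefix_ones /Defs.factor /ones iotaD map_cat count_cat. Qed.

Lemma prefix_onesS (w : iword) (i : nat) :
  prefix_ones w i.+1 = (prefix_ones w i + w i)%N.
Proof. by rewrite -addn1 prefix_onesD /ones /Defs.factor /= addn0; case: (w i). Qed.

Lemma prefix_normal_subadditive (w : iword) :
  (forall k i, prefix_ones w (k + i) <= prefix_ones w k + prefix_ones w i)%N ->
  prefix_normal w.
Proof. by move=> Psub i k _; rewrite -(leq_add2l (prefix_ones w k)) -prefix_onesD. Qed.

Lemma exists_prefix_ones (f : nat -> nat) :
  f 0 = 0 -> (forall n, f n <= f n.+1 <= (f n).+1)%N ->
  exists w : iword, prefix_ones w =1 f.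
Proof.
move=> f0 fS; exists (fun i => f i < f i.+1)%N.
elim=> [|n IHn]; first by rewrite f0.
rewrite prefix_onesS IHn; have := fS n; lia.
Qed.

Lemma ultimately_periodic_prefix_ones (w : iword) :
  ultimately_periodic w ->
  exists a q p, (0 < q)%N /\
    forall i, (a <= i)%N -> prefix_ones w (i + q) = (prefix_ones w i + p)%N.
Proof.
case=> v [u [u_neq0 ->]]; set w' := prepend _ _.
have wq i : (size v <= i)%N -> w' (i + size u) = w' i.
  move=> le_vi; rewrite /w' /prepend /omega_power !ltnNge le_vi.
  by rewrite (leq_trans le_vi) ?leq_addr //= -addnBAC // modnDr.
exists (size v), (size u), (ones (Defs.factor w' (size v) (size u))).
split=> [|i /subnKC <-]; first by rewrite lt0n size_eq0.
elim: (i - size v)%N => [|j IHj]; first by rewrite addn0 prefix_onesD.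
by rewrite addnS addSn !prefix_onesS IHj wq ?leq_addr // addnAC.
Qed.

Lemma prefix_ones_iter (w : iword) (a q p : nat) :
  (forall i, (a <= i)%N -> prefix_ones w (i + q) = (prefix_ones w i + p)%N) ->
  forall k, prefix_ones w (a + k * q) = (prefix_ones w a + k * p)%N.
Proof.
move=> Pq; elim=> [|k IHk]; first by rewrite !addn0.
by rewrite mulSnr addnA Pq ?leq_addr // IHk mulSnr addnA.
Qed.

(** * Minimum density and its rationality in the periodic case *)

Lemma le_min_density (R : realType) (x : R) (w : iword) :
  (forall i, (0 < i)%N -> x * i%:R <= (prefix_ones w i)%:R) ->
  x <= min_density R w.
Proof.
move=> lex; apply: lb_le_inf; first by exists (prefix_density R w 1), 1.
by move=> _ [i /= i_gt0 <-]; rewrite /prefix_density ler_pdivlMr ?ltr0n ?lex.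
Qed.

Lemma min_density_le (R : realType) (w : iword) (i : nat) :
  (0 < i)%N -> min_density R w * i%:R <= (prefix_ones w i)%:R.
Proof.
move=> i_gt0; rewrite -ler_pdivlMr ?ltr0n //; apply: ge_inf; last by exists i.
by exists 0 => _ [j /= _ <-]; rewrite /prefix_density divr_ge0.
Qed.

(** Stands in for limits below: an asymptotic slope is bounded by bounding all its multiples. *)
Lemma archi_le0 (R : realType) (x C : R) :
  (forall k : nat, (0 < k)%N -> k%:R * x <= C) -> x <= 0.
Proof.
move=> kxC; rewrite leNgt; apply/negP => x_gt0.
have := kxC (Num.bound `|C / x|).+1 isT; apply/negP; rewrite -ltNge.
rewrite -ltr_pdivrMr //; apply: le_lt_trans (ler_norm _) _.
by apply: lt_trans (archi_boundP (normr_ge0 _)) _; rewrite ltr_nat.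
Qed.

Lemma min_density_ultimately_periodic (R : realType) (w : iword) :
  ultimately_periodic w -> exists r : rat, min_density R w = ratr r.
Proof.
case/ultimately_periodic_prefix_ones => a [q [p [q_gt0 Pq]]].
have qR : 0 < q%:R :> R by rewrite ltr0n.
(* Index 0 carries no prefix density, so its slot holds the period slope p / q. *)
pose F (i : 'I_(a + q).+1) : rat :=
  if i == ord0 then p%:R / q%:R else (prefix_ones w i)%:R / i%:R.
case: (arg_minP F (erefl : predT ord0)) => i0 _ minF.
exists (F i0).
have ratrF (m n : nat) : ratr (m%:R / n%:R) = m%:R / n%:R :> R.
  by rewrite fmorph_div /= !ratr_nat.
apply/eqP; rewrite eq_le; apply/andP; split.
- rewrite /F; case: ifPn => [_|i0_neq0].
    rewrite ratrF ler_pdivlMr // -subr_le0.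
    (* The density bound at a + k q, with the terms in k collected on the left. *)
    apply: (@archi_le0 R _ ((prefix_ones w a)%:R - min_density R w * a%:R)) => k k0.
    have kq_gt0 : (0 < a + k * q)%N by rewrite addn_gt0 muln_gt0 k0 q_gt0 orbT.
    have := min_density_le R w kq_gt0.
    by rewrite (prefix_ones_iter Pq) !natrD !natrM; lra.
  have i0_gt0 : (0 < i0)%N by rewrite lt0n.
  by rewrite ratrF ler_pdivlMr ?ltr0n // min_density_le.
(* Past a + q, one period is removed: the bound for i - q and [F i0] * q <= p add up to the bound
   for i. *)
- apply: le_min_density; elim/ltn_ind => i IHi i_gt0.
  case: (leqP i (a + q)) => [le_i|lt_i].
    have := minF (Ordinal (le_i : (i < (a + q).+1)%N)) isT.
    rewrite {2}/F -val_eqE /= -[i == 0]negbK -lt0n i_gt0 /=.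
    by rewrite -(ler_rat R) ratrF ler_pdivlMr ?ltr0n.
  have le_ai : (a <= i - q)%N by lia.
  have IH : ratr (F i0) * (i - q)%:R <= (prefix_ones w (i - q))%:R :> R.
    by apply: IHi; lia.
  have := minF ord0 isT; rewrite {2}/F eqxx -(ler_rat R) ratrF ler_pdivlMr //.
  have -> : i = (i - q + q)%N by lia.
  by rewrite Pq // !natrD; lra.
Qed.

(** * The word with prefix counts ceil g *)

(** The coefficient 1 - alpha gives the value 1 at n = 1, so subadditivity alone bounds the
    increments by 1. *)
Definition profile (R : realType) (alpha : R) (n : nat) : R :=
  alpha * n%:R + (1 - alpha) * Num.sqrt n%:R.

Lemma sqrt_natD (R : realType) (m n : nat) :
  Num.sqrt (m + n)%:R <= Num.sqrt m%:R + Num.sqrt n%:R :> R.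
Proof.
rewrite -[leRHS]ger0_norm ?addr_ge0 ?sqrtr_ge0 // -sqrtr_sqr ler_wsqrtr //.
rewrite sqrrD !sqr_sqrtr ?ler0n // natrD -addrA lerD2l lerDr.
by rewrite mulrn_wge0 // mulr_ge0 ?sqrtr_ge0.
Qed.

Lemma profileD (R : realType) (alpha : R) (m n : nat) :
  alpha < 1 -> profile alpha (m + n) <= profile alpha m + profile alpha n.
Proof.
move=> alpha_lt1; have := sqrt_natD R m n; rewrite /profile natrD.
by move: (Num.sqrt _) (Num.sqrt _) (Num.sqrt _) => x y z; nra.
Qed.

Lemma exists_ceil_profile_word (R : realType) (alpha : R) :
  0 < alpha -> alpha < 1 ->
  exists w : iword, forall n,
    profile alpha n <= (prefix_ones w n)%:R < profile alpha n + 1.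
Proof.
move=> alpha_gt0 alpha_lt1; set g := profile alpha.
have g1 : g 1 = 1 by rewrite /g /profile sqrtr1; lra.
have g_ge0 n : 0 <= g n.
  by rewrite addr_ge0 // mulr_ge0 ?ler0n ?sqrtr_ge0 //; lra.
have gS n : g n <= g n.+1.
  by rewrite lerD // ler_wpM2l ?ler_wsqrtr ?ler_nat //; lra.
pose f n := `|Num.ceil (g n)|%N.
have fP n : g n <= (f n)%:R < g n + 1.
  rewrite /f natr_absz ger0_norm ?ceil_ge0 ?(lt_le_trans _ (g_ge0 n)) ?ltrN10 //.
  by have := ceilB1_lt (g n); rewrite ceil_ge intrB ltrBlDr.
have [||w Pw] := @exists_prefix_ones f.
- by rewrite /f /g /profile sqrtr0 !mulr0 addr0 ceil0.
- move=> n; apply/andP; split; rewrite -ltnS -(ltr_nat R) -?natr1.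
    by have := fP n; have := fP n.+1; have := gS n; lra.
  have := fP n; have := fP n.+1; have := @profileD R alpha n 1 alpha_lt1.
  by rewrite -/g g1 addn1; lra.
by exists w => n; rewrite Pw.
Qed.

(** P (k + i) < g (k + i) + 1 <= g k + g i + 1 <= P k + P i + 1, and the outer terms are
    integers. *)
Lemma ceil_profile_prefix_normal (R : realType) (alpha : R) (w : iword) :
  alpha < 1 ->
  (forall n, profile alpha n <= (prefix_ones w n)%:R < profile alpha n + 1) ->
  prefix_normal w.
Proof.
move=> alpha_lt1 wP; apply: prefix_normal_subadditive => k i.
rewrite -ltnS -(ltr_nat R) -natr1 natrD.
have := wP k; have := wP i; have := wP (k + i)%N.
by have := @profileD R alpha k i alpha_lt1; lra.
Qed.

Lemma sqrt_natMM (R : realType) (m : nat) : Num.sqrt (m * m)%:R = m%:R :> R.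
Proof. by rewrite natrM -expr2 sqrtr_sqr ger0_norm. Qed.

Lemma ceil_profile_min_density (R : realType) (alpha : R) (w : iword) :
  0 < alpha -> alpha < 1 ->
  (forall n, profile alpha n <= (prefix_ones w n)%:R < profile alpha n + 1) ->
  min_density R w = alpha.
Proof.
move=> alpha_gt0 alpha_lt1 wP; apply/eqP; rewrite eq_le; apply/andP; split.
  (* At n = m^2 the density d satisfies d m^2 < alpha m^2 + (1 - alpha) m + 1; dividing by m gives m
     (d - alpha) <= 2. *)
  rewrite -subr_le0; apply: (@archi_le0 R _ 2) => m m_gt0.
  have m_ge1 : 1 <= m%:R :> R by rewrite ler1n.
  have := @min_density_le R w (m * m) _; rewrite muln_gt0 m_gt0 => /(_ isT).
  have /andP[_] := wP (m * m)%N; rewrite /profile sqrt_natMM natrM.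
  move: (min_density R w) (prefix_ones _ _)%:R m%:R m_ge1 => d P x x1 h1 h2.
  by rewrite -(ler_pM2l (_ : 0 < x)); nra.
apply: le_min_density => i _; have /andP[+ _] := wP i; apply: le_trans.
by rewrite lerDl mulr_ge0 ?sqrtr_ge0 //; lra.
Qed.

Lemma ceil_profile_aperiodic (R : realType) (alpha : R) (w : iword) :
  0 < alpha -> alpha < 1 ->
  (forall n, profile alpha n <= (prefix_ones w n)%:R < profile alpha n + 1) ->
  aperiodic w.
Proof.
move=> alpha_gt0 alpha_lt1 wP.
case/ultimately_periodic_prefix_ones => a [q [p [q_gt0 Pq]]].
have qR : 1 <= q%:R :> R by rewrite ler1n.
pose c : R := (prefix_ones w a)%:R.
have c_ge0 : 0 <= c by [].
(* sampling at n = a + m^2 q, where m <= sqrt n <= a + m q *)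
have sample (m : nat) : (0 < m)%N ->
    (1 - alpha) * m%:R <= c + m%:R ^+ 2 * (p%:R - alpha * q%:R) <=
    alpha * a%:R + (1 - alpha) * (a%:R + m%:R * q%:R) + 1.
  move=> m_gt0; have := wP (a + m * m * q)%N.
  rewrite (prefix_ones_iter Pq) /profile.
  have : m%:R <= Num.sqrt (a + m * m * q)%:R :> R.
    by rewrite -[leLHS]sqrt_natMM ler_wsqrtr // ler_nat; nia.
  have : Num.sqrt (a + m * m * q)%:R <= a%:R + m%:R * q%:R :> R.
    rewrite -natrM -natrD -[leRHS]sqrt_natMM ler_wsqrtr // ler_nat.
    have le_aa : (a <= a * a)%N by case: (a) => // n; rewrite leq_pmulr.
    have : (m * m * q <= m * q * (m * q))%N by rewrite mulnACA leq_mul ?leq_pmulr.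
    rewrite mulnDl !mulnDr; lia.
  have a_ge0 : 0 <= a%:R :> R by [].
  rewrite !natrD !natrM -/c; move: (Num.sqrt _) => s; nra.
(* The left side of the upper estimate is quadratic in m and the right side linear, so the quadratic
   coefficient cannot be positive. *)
have beta_le0 : p%:R - alpha * q%:R <= 0.
  apply: (@archi_le0 R _ (a%:R + q%:R + 1)) => m m_gt0.
  have /andP[_ upper] := sample m m_gt0.
  have m_ge1 : 1 <= m%:R :> R by rewrite ler1n.
  have ma_ge0 : 0 <= (m%:R - 1) * a%:R :> R by rewrite mulr_ge0 // subr_ge0.
  have amq_ge0 : 0 <= alpha * (m%:R * q%:R) by rewrite mulr_ge0 ?mulr_ge0 //; lra.
  rewrite -(ler_pM2l (_ : 0 < m%:R :> R)) ?ltr0n //; lra.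
(* Without a positive quadratic term, the lower estimate leaves (1 - alpha) m <= c for all m > 0. *)
suff : 1 - alpha <= 0 by lra.
apply: (@archi_le0 R _ c) => m m_gt0; have /andP[+ _] := sample m m_gt0.
have : 0 <= m%:R ^+ 2 :> R by rewrite sqr_ge0.
by move: (p%:R - _) beta_le0 (_ ^+ 2) => b b0 y; nra.
Qed.

Theorem theorem1 (R : realType) :
  (forall alpha : R, 0 < alpha -> alpha < 1 ->
     exists w : iword,
       [/\ aperiodic w, prefix_normal w & min_density R w = alpha]) /\
  (forall w : iword, ultimately_periodic w -> prefix_normal w ->
     exists q : rat, min_density R w = ratr q).
Proof.
split=> [alpha alpha_gt0 alpha_lt1|w w_per _].
  have [w wP] := exists_ceil_profile_word alpha_gt0 alpha_lt1.
  exists w; split; first exact: ceil_profile_aperiodic wP.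
    exact: ceil_profile_prefix_normal wP.
  exact: ceil_profile_min_density wP.
exact: min_density_ultimately_periodic.
Qed.
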